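(* Let $n\ge 2$ be an integer and let $b,c_1,c_2\in\mathbb{Z}_2$. Let $T_f:\mathcal{T}_n\to\mathcal{T}_n$ be the linear cellular automaton on the binary tree of height $n$ over $\mathbb{Z}_2$ with periodic boundary condition and local rule $f(x_0,x_1,x_2)=bx_0+c_1x_1+c_2x_2\pmod 2$. Then $T_f$ is reversible if and only if $b=1$ and $c_1+c_2=0$ in $\mathbb{Z}_2$.
   Context: Let $\Sigma=\{1,2\}$, let $\Sigma_{n-1}$ be the set of words over $\Sigma$ of length at most $n-1$ (including the empty word $\epsilon$, the root), and $\mathcal{T}_n=\mathbb{Z}_2^{\Sigma_{n-1}}$. The linear cellular automaton with periodic boundary condition is given by $(T_ft)_x=f(t_x,t_{x1},t_{x2})$ if $|x|\le n-2$ and $(T_ft)_x=f(t_x,t_\epsilon,t_\epsilon)$ if $|x|=n-1$. $T_f$ is reversible if every configuration in $\mathcal{T}_n$ has exactly one preimage under $T_f$, i.e. $T_f$ is a bijection. *)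

(* Defs.v *)
From mathcomp Require Import all_boot all_order all_algebra.
Set Implicit Arguments.
Unset Strict Implicit.
Unset Printing Implicit Defensive.

Import GRing.Theory.
Local Open Scope ring_scope.

(* The letters 1 and 2 of the alphabet are the elements 0 and 1 of 'I_2. *)
Definition letter1 : 'I_2 := ord0.
Definition letter2 : 'I_2 := ord_max.

(* Words of length at most n - 1. Words grow on the right: the children of x
   are x1 and x2. *)
Definition node (n : nat) : finType := (n - 1).-bseq 'I_2.

Definition root (n : nat) : node n := [bseq].

(* Only meaningful for size x < n - 1; otherwise insub_bseq returns the root. *)
Definition child (n : nat) (x : node n) (a : 'I_2) : node n :=
  insub_bseq (n - 1) (rcons x a).

Definition config (n : nat) := {ffun node n -> 'Z_2}.

Definition periodic_ca (n : nat) (f : 'Z_2 -> 'Z_2 -> 'Z_2 -> 'Z_2)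
    (t : config n) : config n :=
  [ffun x : node n =>
    if (size x <= n - 2)%N then f (t x) (t (child x letter1)) (t (child x letter2))
    else f (t x) (t (root n)) (t (root n))].

Definition linear_rule (b c1 c2 : 'Z_2) (x0 x1 x2 : 'Z_2) : 'Z_2 :=
  b * x0 + c1 * x1 + c2 * x2.

Definition reversible (n : nat) (T : config n -> config n) : Prop :=
  forall s : config n, exists! t : config n, T t = s.

(* Main.v *)
Require Import Defs.
From mathcomp Require Import all_boot all_order all_algebra.
From mathcomp Require Import zify.

Import GRing.Theory.
Local Open Scope ring_scope.

(** At a leaf the automaton returns b t_x + (c1 + c2) t_root. If b = 1 and
    c1 + c2 = 0, the values at the leaves are therefore kept, and the other
    values are recovered level by level, going up; so the automaton is injective
    on a finite set. If b = 0, all leaves get the same value, and there are at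
    least two of them, so surjectivity fails. If b = 1 and c1 + c2 = 1, the
    constant configuration 1 is sent to 0. *)

Lemma Z2_cases (a : 'Z_2) : a = 0 \/ a = 1.
Proof. by case: a => [[|[|m]]] // i; [left|right]; apply: val_inj. Qed.

Lemma size_child (n : nat) (x : node n) (a : 'I_2) :
  (size x < n - 1)%N -> size (child x a) = (size x).+1.
Proof. by move=> hx; rewrite /child insubdK ?size_rcons // unfold_in size_rcons. Qed.

Lemma periodic_ca_leaf (n : nat) (b c1 c2 : 'Z_2) (t : config n) (x : node n) :
  (n - 2 < size x)%N ->
  periodic_ca (linear_rule b c1 c2) t x = b * t x + (c1 + c2) * t (Defs.root n).
Proof. by move=> hx; rewrite ffunE leqNgt hx /linear_rule mulrDl addrA. Qed.

(** On a constant configuration both branches of the rule read the same three values, so leaves need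
    no separate treatment. *)
Lemma periodic_ca_cst (n : nat) (b c1 c2 a : 'Z_2) :
  periodic_ca (linear_rule b c1 c2) [ffun=> a] =
    [ffun=> (b + (c1 + c2)) * a] :> config n.
Proof.
by apply/ffunP => x; rewrite !ffunE /linear_rule !mulrDl addrA; case: ifP.
Qed.

Lemma periodic_ca_inj (n : nat) (c1 c2 : 'Z_2) :
  (2 <= n)%N -> c1 + c2 = 0 ->
  injective (@periodic_ca n (linear_rule 1 c1 c2)).
Proof.
move=> hn hc t t' /ffunP eqT; apply/ffunP => x.
(* The measure [n - size x] drops from a node to its children. *)
have [k] := ubnP (n - size x); elim: k x => // k IHk x hx.
have := eqT x; have [hs|hs] := leqP (size x) (n - 2); last first.
  by rewrite !periodic_ca_leaf // hc !mul1r !mul0r !addr0.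
have eq_child a : t (child x a) = t' (child x a).
  by apply: IHk; rewrite size_child; lia.
by rewrite !ffunE hs /linear_rule !eq_child !mul1r => /addIr/addIr.
Qed.

Lemma periodic_ca_not_surj (n : nat) (c1 c2 : 'Z_2) :
  (2 <= n)%N ->
  exists s : config n, forall t, periodic_ca (linear_rule 0 c1 c2) t <> s.
Proof.
move=> hn; pose leaf a : node n := insub_bseq (n - 1) (nseq (n - 1) a).
have leafE a : leaf a = nseq (n - 1) a :> seq _.
  by rewrite insubdK // unfold_in size_nseq.
have size_leaf a : (n - 2 < size (leaf a))%N by rewrite leafE size_nseq; lia.
have leaf_neq : leaf letter2 != leaf letter1.
  apply/eqP => /(congr1 val); rewrite /= !leafE.
  (* As [2 <= n], both words are nonempty, and their first letters differ. *)
  by have -> : (n - 1 = (n - 2).+1)%N by lia.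
(* The indicator of one leaf separates the two leaves, whereas an image takes the value
   [(c1 + c2) * t (root n)] at both. *)
exists [ffun x => (x == leaf letter1)%:R] => t /ffunP eqs.
have := eqs (leaf letter2); have := eqs (leaf letter1).
by rewrite !periodic_ca_leaf // !mul0r !ffunE eqxx (negbTE leaf_neq) => ->.
Qed.

Theorem proposition3p1 (n : nat) (hn : (2 <= n)%N) (b c1 c2 : 'Z_2) :
  reversible (@periodic_ca n (linear_rule b c1 c2)) <-> b = 1 /\ c1 + c2 = 0.
Proof.
split=> [rev | [-> hc] s]; last first.
  have injT := periodic_ca_inj _ _ _ hn hc.
  exists (invF injT s); split=> [|t <-]; first exact: f_invF.
  exact: invF_f.
case: (Z2_cases b) rev => -> rev.
  have [s hs] := periodic_ca_not_surj _ c1 c2 hn.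
  by have [t [/hs]] := rev s.
split=> //; case: (Z2_cases (c1 + c2)) => // hc.
(* Both constants are preimages of 0, as 1 + 1 = 0 in ['Z_2]; uniqueness equates them. *)
have [u [_ uniq_u]] := rev [ffun=> 0].
have u1 : u = [ffun=> 1].
  apply: uniq_u; rewrite periodic_ca_cst hc mulr1.
  by apply/ffunP => x; rewrite !ffunE; apply: val_inj.
have u0 : u = [ffun=> 0] by apply: uniq_u; rewrite periodic_ca_cst mulr0.
by have := congr1 (fun v : config n => v (Defs.root n)) u1; rewrite /= u0 !ffunE.
Qed.
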